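(* The Factor strategy is productive. Concretely: let $\mathcal{T}=((t,u),\mathcal{O},\mathcal{R})$ be a tiling, $\mathcal{A}=\operatorname{Grid}(\mathcal{T})$, and let $P=\{P_1,\ldots,P_m\}$ be a partition of the nonempty cells of $\mathcal{T}$ into non-interacting parts, with children $\mathcal{B}^{(1)},\ldots,\mathcal{B}^{(m)}$ as defined in the context, each of which contains a gridded permutation of size at least $1$. Let $S=\{i\in\{1,\ldots,m\}: |\mathcal{B}^{(j)}_0|=0 \text{ for some } j\ne i\}$, and use the reliance profile $r(n)=(r^{(1)}(n),\ldots,r^{(m)}(n))$ with $r^{(i)}(n)=n-1$ if $i\in S$ and $r^{(i)}(n)=n$ if $i\notin S$. Then: (1) $r^{(i)}(n)\le n$ for all $i,n$; and (2) for every $i$ such that $r^{(i)}(N)\ge N$ for some $N$ (i.e., $i\notin S$), we have $|\mathcal{A}_n|\ge|\mathcal{B}^{(i)}_n|$ for all $n\in\mathbb{N}$ and $|\mathcal{A}_\ell|>|\mathcal{B}^{(i)}_\ell|$ for some $\ell\in\mathbb{N}$.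
   Context: A gridded permutation of size $n$ is a pair $(\pi,(c_1,\ldots,c_n))$ with $\pi$ a permutation of $\{1,\ldots,n\}$ and cells $c_i=(x_i,y_i)\in\mathbb{N}^2$ such that $x_i\le x_j$ whenever $i<j$ and $y_i\le y_j$ whenever $\pi(i)<\pi(j)$; $\mathcal{G}^{(t,u)}$ is the set of those with all cells in $\{0,\ldots,t-1\}\times\{0,\ldots,u-1\}$. Containment: $g$ contains $h$ if some subsequence of $g$'s permutation is order-isomorphic to $h$'s permutation and the corresponding cells of $g$ equal the cells of $h$. A tiling $((t,u),\mathcal{O},\mathcal{R})$ has obstructions $\mathcal{O}$ and requirement lists $\mathcal{R}$; $\operatorname{Grid}$ consists of elements of $\mathcal{G}^{(t,u)}$ avoiding all obstructions and containing at least one element of each requirement list. A cell $c$ is empty if $(1,(c))\in\mathcal{O}$, nonempty otherwise. For a set $\mathcal{X}$ of gridded permutations, $\mathcal{X}_n$ is its set of elements of size $n$. The parts of $P$ are non-interacting: no cell of one part shares a row or a column with a cell of a different part, no obstruction has entries in cells of two different parts, and for each requirement list there is a single part containing all cells used by all its members. The child $\mathcal{B}^{(i)}$ is the set of gridded permutations all of whose entries lie in cells of $P_i$, that avoid every obstruction of $\mathcal{T}$ and that contain at least one element of each requirement list of $\mathcal{T}$ whose cells lie in $P_i$ (the tiling obtained by restricting $\mathcal{T}$ to the rows and columns of $P_i$). The counting functions of the strategy are $c_{(n)}(b^{(1)},\ldots,b^{(m)})=\sum b^{(1)}_{i_1}\cdots b^{(m)}_{i_m}$ over $(i_1,\ldots,i_m)\in\{0,\ldots,n\}^m$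 with $i_1+\cdots+i_m=n$ and $i_\ell\ne n$ whenever $\ell\in S$. Condition (1) and (2) of the claim are exactly the two conditions defining a productive strategy (the parent at size $N$ relies on child $i$ at size $j$ iff $0\le j\le r^{(i)}(N)$).
   Formalization: The formal statement assumes m ≠ 1: for m = 1 the set S is empty and the only child equals Grid(T), so the strict inequality in (2) always fails (for example, for the 1×1 tiling with no obstructions or requirements). *)

(* Defs.v *)
From HB Require Import structures.
From mathcomp Require Import all_boot all_order all_fingroup all_algebra.
From mathcomp Require Import finmap.
From mathcomp Require Import all_classical.

Set Implicit Arguments.
Unset Strict Implicit.
Unset Printing Implicit Defensive.

Local Open Scope classical_set_scope.

(* (column, row), counted from 0 *)
Definition cell : Type := (nat * nat)%type.

(* Positions and values are numbered 0..n-1 rather than 1..n. *)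
Record gperm : Type := GPerm {
  gsize : nat;
  gpi : {perm 'I_gsize};
  gcell : 'I_gsize -> cell;
  gcell_col : forall i j : 'I_gsize, i < j -> (gcell i).1 <= (gcell j).1;
  gcell_row : forall i j : 'I_gsize,
    gpi i < gpi j -> (gcell i).2 <= (gcell j).2 }.

Arguments gpi : clear implicits.
Arguments gcell : clear implicits.

HB.instance Definition _ := gen_eqMixin gperm.
HB.instance Definition _ := gen_choiceMixin gperm.

Definition gcontains (g h : gperm) : Prop :=
  exists f : 'I_(gsize h) -> 'I_(gsize g),
    [/\ forall i j : 'I_(gsize h), i < j -> f i < f j,
        forall i j : 'I_(gsize h), (gpi h i < gpi h j) = (gpi g (f i) < gpi g (f j))
      & forall i : 'I_(gsize h), gcell g (f i) = gcell h i].

Definition cells_in (C : set cell) (g : gperm) : Prop :=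
  forall i : 'I_(gsize g), C (gcell g i).

Definition rect (t u : nat) : set cell := [set c | (c.1 < t) && (c.2 < u)].

Definition gridded (t u : nat) : set gperm := [set g | cells_in (rect t u) g].

(* the gridded permutation (1, (c)) *)
Definition gpoint (c : cell) : gperm :=
  @GPerm 1 1%g (fun=> c) (fun _ _ _ => leqnn _) (fun _ _ _ => leqnn _).

Record tiling : Type := Tiling {
  tcols : nat;
  trows : nat;
  obstructions : set gperm;
  requirements : set (set gperm) }.

Definition avoids_obstructions (T : tiling) (g : gperm) : Prop :=
  forall o, obstructions T o -> ~ gcontains g o.

Definition satisfies (g : gperm) (L : set gperm) : Prop :=
  exists2 h, L h & gcontains g h.

Definition Grid (T : tiling) : set gperm :=
  [set g | [/\ gridded (tcols T) (trows T) g,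
               avoids_obstructions T g
             & forall L, requirements T L -> satisfies g L]].

Definition nonempty_cells (T : tiling) : set cell :=
  [set c | rect (tcols T) (trows T) c /\ ~ obstructions T (gpoint c)].

Definition of_size (X : set gperm) (n : nat) : set gperm :=
  [set g | X g /\ gsize g = n].

(* fset_set returns fset0 on infinite sets; every class counted below is
   contained in some gridded t u, where finite_of_size applies. *)
Definition gcount (X : set gperm) (n : nat) : nat :=
  #|` fset_set (of_size X n) |.

Lemma finite_of_size (t u n : nat) (X : set gperm) :
  X `<=` gridded t u -> finite_set (of_size X n).
Proof.
move=> sX.
pose D : Type := ({perm 'I_n} * {ffun 'I_n -> 'I_t * 'I_u})%type.
pose cl (x : D) (i : 'I_n) : cell := (val (x.2 i).1, val (x.2 i).2).
pose valid (x : D) :=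
  (forall i j : 'I_n, i < j -> (cl x i).1 <= (cl x j).1) /\
  (forall i j : 'I_n, x.1 i < x.1 j -> (cl x i).2 <= (cl x j).2).
pose F (x : D) : gperm :=
  match pselect (valid x) with
  | left v => @GPerm n x.1 (cl x) v.1 v.2
  | right _ => gpoint (0, 0)
  end.
apply: (@sub_finite_set _ _ (F @` [set: D])); last first.
  exact/finite_image/finite_finset.
move=> [k p c cc cr] [/sX /= hc /= ek]; subst k.
have h1 i : (c i).1 < t by have /andP[] := hc i.
have h2 i : (c i).2 < u by have /andP[] := hc i.
pose x : D := (p, [ffun i => (Ordinal (h1 i), Ordinal (h2 i))]).
have ec : cl x = c.
  by apply/funext => i; rewrite /cl /x /= ffunE /=; case: (c i).
exists x => //; rewrite /F; case: pselect => [v|[]]; last by split; rewrite ec.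
move: v; rewrite /valid ec => -[v1 v2] /=.
by congr (@GPerm n p c _ _); apply: Prop_irrelevance.
Qed.

Definition list_cells_in (C : set cell) (L : set gperm) : Prop :=
  forall h, L h -> cells_in C h.

Definition non_interacting (T : tiling) (m : nat) (P : 'I_m -> set cell) : Prop :=
  [/\ forall i j, i != j -> forall c d, P i c -> P j d ->
        c.1 <> d.1 /\ c.2 <> d.2,
      forall i j, i != j -> forall o, obstructions T o ->
        ~ exists k l : 'I_(gsize o), P i (gcell o k) /\ P j (gcell o l)
    & forall L, requirements T L -> exists i, list_cells_in (P i) L].

Definition child (T : tiling) (C : set cell) : set gperm :=
  [set g | [/\ cells_in C g,
               avoids_obstructions T g
             & forall L, requirements T L -> list_cells_in C L -> satisfies g L]].

Lemma Grid_gridded (T : tiling) : Grid T `<=` gridded (tcols T) (trows T).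
Proof. by move=> g []. Qed.

Lemma child_gridded (T : tiling) (m : nat) (P : 'I_m -> set cell) (i : 'I_m) :
  classical_sets.partition [set: 'I_m] P (nonempty_cells T) ->
  child T (P i) `<=` gridded (tcols T) (trows T).
Proof.
move=> [cP _ _] g [gP _ _] k; suff [] : nonempty_cells T (gcell g k) by [].
by rewrite -cP; exists i.
Qed.

Definition factor_S (m : nat) (B : 'I_m -> set gperm) : set 'I_m :=
  [set i | exists j, j != i /\ gcount (B j) 0 = 0].

(* Valued in int: r^(i)(0) = -1 when i is in S, so truncated subtraction would
   make the parent at size 0 rely on such a child at size 0. *)
Definition factor_reliance (m : nat) (B : 'I_m -> set gperm) (i : 'I_m) (n : nat)
  : int :=
  if `[< factor_S B i >] then (n%:Z - 1)%R else (n%:Z)%R.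

Definition productive (m : nat) (A : set gperm) (B : 'I_m -> set gperm)
    (r : 'I_m -> nat -> int) : Prop :=
  (forall i n, (r i n <= n%:Z)%R) /\
  (forall i, (exists N : nat, (N%:Z <= r i N)%R) ->
     (forall n, gcount (B i) n <= gcount A n) /\
     (exists l, gcount (B i) l < gcount A l)).

Lemma factor_reliance_geP (m : nat) (B : 'I_m -> set gperm) (i : 'I_m) :
  (exists N : nat, (N%:Z <= factor_reliance B i N)%R) <-> ~ factor_S B i.
Proof.
rewrite /factor_reliance; case: asboolP => [Si|nSi]; split => //.
- by move=> [N]; rewrite Num.Theory.lerBrDr Num.Theory.gerDl.
- by move=> _; exists 0.
Qed.

(* Main.v *)
(* If [i] is not in [S], every child other than the [i]-th contains the empty
   gridded permutation, so every requirement list living in another part has an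
   empty member and is satisfied by anything: hence child [i] is contained in
   [Grid T].  The inclusion is strict at some size: take [g] in child [i], a
   point [c] of a nonempty member [h] of another child [j], and insert [c] into
   [g].  An obstruction of the result lies in a single part, so it is either an
   obstruction of [g] or the point [c], hence an obstruction of [h]. *)
Require Import Defs.
From mathcomp Require Import all_boot all_order all_fingroup all_algebra.
From mathcomp Require Import finmap zify.
From mathcomp Require Import all_classical.

Local Open Scope classical_set_scope.

(** The cut is the least index from which on all values are at least [a]. It ranges over ['I_n.+1]
    because it may come after every index. *)
Lemma monotone_cut (n : nat) (F : 'I_n -> nat) (a : nat) :
  (forall x y : 'I_n, x < y -> F x <= F y) ->
  exists p : 'I_n.+1, forall x : 'I_n, (x < p) = (F x < a).
Proof.
move=> mF.
pose Q p := [forall x : 'I_n, (p <= x) ==> (a <= F x)].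
have exQ : exists p, Q p.
  by exists n; apply/forallP => x; rewrite leqNgt ltn_ord.
case: (ex_minnP exQ) => p /forallP Qp minp.
have pn : p < n.+1.
  by rewrite ltnS; apply: minp; apply/forallP => x; rewrite leqNgt ltn_ord.
exists (Ordinal pn) => x /=; case: (ltnP x p) => [xp|px]; last first.
  by have := Qp x; rewrite px /= ltnNge => ->.
apply/esym; rewrite ltnNge; apply/negP => aF.
(* With [a <= F x], monotonicity makes [x] a candidate for the cut, against the minimality of [p],
   since [x < p]. *)
have /minp : Q x.
  apply/forallP => y; apply/implyP; rewrite leq_eqVlt => /orP[/eqP/val_inj <-//|].
  by move=> /mF; apply: leq_trans.
by rewrite leqNgt xp.
Qed.

Lemma ltn_lift2 (n : nat) (p : 'I_n.+1) (x y : 'I_n) :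
  (lift p x < lift p y) = (x < y).
Proof. by rewrite /= /bump; case: (leqP p x); case: (leqP p y); lia. Qed.

Lemma ltn_liftl (n : nat) (p : 'I_n.+1) (x : 'I_n) : (lift p x < p) = (x < p).
Proof. by rewrite /= /bump; case: (leqP p x); lia. Qed.

(** Index [p] itself is moved up by [lift p], whence the weak inequality on the right. *)
Lemma ltn_liftr (n : nat) (p : 'I_n.+1) (x : 'I_n) : (p < lift p x) = (p <= x).
Proof. by rewrite /= /bump; case: (leqP p x); lia. Qed.

Definition insert_cell (n : nat) (p : 'I_n.+1) (c : cell) (F : 'I_n -> cell)
    (k : 'I_n.+1) : cell :=
  if unlift p k is Some x then F x else c.

Lemma insert_cell_id n p c F : @insert_cell n p c F p = c.
Proof. by rewrite /insert_cell unlift_none. Qed.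

Lemma insert_cell_lift n p c F x : @insert_cell n p c F (lift p x) = F x.
Proof. by rewrite /insert_cell liftK. Qed.

(** The new entry takes the position just after the entries in columns left of [c] and the value
    just above the entries in rows below [c], so cells stay monotone in position and in value. The
    old entries are embedded by [e], which is [lift p]. *)
Lemma gperm_insert (g : gperm) (c : cell) :
  exists (k : gperm) (p : 'I_(gsize k)) (e : 'I_(gsize g) -> 'I_(gsize k)),
    [/\ gsize k = (gsize g).+1, gcell k p = c,
        forall q, q = p \/ exists x, q = e x,
        (forall x y, (e x < e y) = (x < y)) /\
          (forall x y, (gpi k (e x) < gpi k (e y)) = (gpi g x < gpi g y))
      & forall x, gcell k (e x) = gcell g x].
Proof.
case: g => n s F Fcol Frow.
have [p pP] := @monotone_cut n (fun x => (F x).1) c.1 Fcol.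
(* Listing the cells by value, through the inverse of [s], turns the row condition into monotonicity
   in the index, so the same cut lemma applies. *)
have rowV (x y : 'I_n) : x < y -> (F (s^-1 x)%g).2 <= (F (s^-1 y)%g).2.
  by move=> xy; apply: Frow; rewrite !permKV.
have [v vP] := @monotone_cut n (fun x => (F (s^-1 x)%g).2) c.2 rowV.
have kcol (i j : 'I_n.+1) : i < j ->
    (insert_cell n p c F i).1 <= (insert_cell n p c F j).1.
  case: (unliftP p i) => [x|] ->; case: (unliftP p j) => [y|] ->;
    rewrite ?insert_cell_lift ?insert_cell_id ?ltnn //.
  - by rewrite ltn_lift2; apply: Fcol.
  - by rewrite ltn_liftl pP => /ltnW.
  - by rewrite ltn_liftr leqNgt pP -leqNgt.
have krow (i j : 'I_n.+1) : lift_perm p v s i < lift_perm p v s j ->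
    (insert_cell n p c F i).2 <= (insert_cell n p c F j).2.
  case: (unliftP p i) => [x|] ->; case: (unliftP p j) => [y|] ->;
    rewrite ?insert_cell_lift ?insert_cell_id ?lift_perm_lift ?lift_perm_id ?ltnn //.
  - by rewrite ltn_lift2; apply: Frow.
  - by rewrite ltn_liftl vP permK => /ltnW.
  - by rewrite ltn_liftr leqNgt vP permK -leqNgt.
exists (@GPerm n.+1 (lift_perm p v s) (insert_cell n p c F) kcol krow), p, (lift p).
split => //=.
- exact: insert_cell_id.
- by move=> q; case: (unliftP p q) => [x|] ->; [right; exists x|left].
- split=> x y; first exact: ltn_lift2.
  by rewrite !lift_perm_lift ltn_lift2.
- exact: insert_cell_lift.
Qed.

Lemma gcontains_trans (g h k : gperm) :
  gcontains g h -> gcontains h k -> gcontains g k.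
Proof.
move=> [f [fm fp fc]] [f' [fm' fp' fc']]; exists (f \o f'); split=> /=.
- by move=> i j /fm'/fm.
- by move=> i j; rewrite fp' fp.
- by move=> i; rewrite fc fc'.
Qed.

Lemma gcontains_size0 (g h : gperm) : gsize h = 0 -> gcontains g h.
Proof.
move=> h0; have F (i : 'I_(gsize h)) : False by case: i; rewrite h0.
by exists (fun i => False_rect _ (F i)); split=> i; case: (F i).
Qed.

(** A strictly increasing map is injective. *)
Lemma gcontains_gsize (g h : gperm) : gcontains g h -> gsize h <= gsize g.
Proof.
case=> f [fm _ _]; rewrite -[gsize h]card_ord -[gsize g]card_ord.
apply: (leq_card f) => x y fxy; apply/val_inj; case: (ltngtP x y) => // /fm;
  by rewrite fxy ltnn.
Qed.

Lemma gcount_gt0_ex (X : set gperm) (n : nat) :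
  gcount X n <> 0 -> exists2 g, X g & gsize g = n.
Proof.
move=> cX; apply: contrapT => nX; apply: cX; rewrite /gcount.
suff -> : of_size X n = set0 by rewrite fset_set0 cardfs0.
by rewrite -subset0 => g [Xg gn]; apply: nX; exists g.
Qed.

(** The bounding rectangle makes both sets finite, so [fset_set] reflects inclusion. *)
Lemma fset_set_of_size_sub (t u n : nat) (X Y : set gperm) :
  X `<=` Y -> Y `<=` gridded t u ->
  (fset_set (of_size X n) `<=` fset_set (of_size Y n))%fset.
Proof.
move=> XY YG; rewrite -fset_set_sub; first by move=> g [/XY Yg gn].
- by apply: (@finite_of_size t u) => g /XY/YG.
- exact: (@finite_of_size t u).
Qed.

Lemma leq_gcount (t u n : nat) (X Y : set gperm) :
  X `<=` Y -> Y `<=` gridded t u -> gcount X n <= gcount Y n.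
Proof. by move=> XY YG; apply/fsubset_leq_card/(fset_set_of_size_sub t u). Qed.

Lemma ltn_gcount (t u : nat) (X Y : set gperm) (g : gperm) :
  X `<=` Y -> Y `<=` gridded t u -> Y g -> ~ X g ->
  gcount X (gsize g) < gcount Y (gsize g).
Proof.
move=> XY YG Yg nXg; apply/fproper_ltn_card/andP.
split; first exact: (fset_set_of_size_sub t u).
have finX : finite_set (of_size X (gsize g)).
  by apply: (@finite_of_size t u) => k /XY/YG.
have finY : finite_set (of_size Y (gsize g)) by exact: (@finite_of_size t u).
apply/negP; rewrite -(fset_set_sub finY finX) => /(_ g (conj Yg erefl)).
by case.
Qed.

Lemma child_sub_Grid (T : tiling) (m : nat) (P : 'I_m -> set cell) (i : 'I_m) :
  classical_sets.partition [set: 'I_m] P (nonempty_cells T) ->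
  non_interacting T P -> ~ factor_S (fun j => child T (P j)) i ->
  child T (P i) `<=` Grid T.
Proof.
move=> Ppart [_ _ Preq] niS g gi; have [_ gO gR] := gi.
split=> //; first exact: (child_gridded Ppart gi).
move=> L RL; have [j LPj] := Preq L RL.
have [ji|ji] := eqVneq j i; first by apply: gR; rewrite // -ji.
(* The empty member [g0] of child [j] contains some [h] in [L], and this [h] is then empty too. *)
have /gcount_gt0_ex[g0 [_ _ /(_ L RL LPj)[h Lh g0h]] g00] :
  gcount (child T (P j)) 0 <> 0 by move=> cj; apply: niS; exists j.
exists h => //; apply: gcontains_size0.
by have := gcontains_gsize _ _ g0h; rewrite g00 leqn0 => /eqP.
Qed.

Lemma Grid_minus_child (T : tiling) (m : nat) (P : 'I_m -> set cell)
    (i j : 'I_m) (g h : gperm) :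
  classical_sets.partition [set: 'I_m] P (nonempty_cells T) ->
  non_interacting T P -> j != i ->
  Grid T g -> child T (P i) g -> child T (P j) h -> 1 <= gsize h ->
  exists2 k, Grid T k & ~ child T (P i) k.
Proof.
move=> Ppart [Pdisj Pobs _] ji [gG gO gR] [gPi _ _] hj h1.
have hG := child_gridded Ppart hj; case: (hj) => hPj hO _.
pose x0 : 'I_(gsize h) := Ordinal h1.
have [k [p [e [_ kp kcov [emono eperm] ecell]]]] := gperm_insert g (gcell h x0).
have kg : gcontains k g.
  by exists e; split=> // a b; rewrite ?emono // eperm.
have nPi : ~ P i (gcell k p).
  by rewrite kp => Pip; have [] := Pdisj _ _ ji _ _ (hPj x0) Pip.
exists k; last by case=> /(_ p).
split.
- by move=> q; case: (kcov q) => [->|[x ->]]; rewrite ?kp ?ecell; [exact: hG|exact: gG].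
- move=> o Oo [f [fmono fperm fcell]].
  (* Either the occurrence of [o] uses the new entry [p] or it does not. If it does, an entry of [o]
     placed elsewhere would lie in [P i], and [o] would meet two parts; so all of [o] sits at
     [p]. *)
  have [[x fx]|nfp] := pselect (exists x, f x = p).
    have fall y : f y = p.
      case: (kcov (f y)) => // -[z fy]; exfalso.
      apply: (Pobs j i ji o Oo); exists x, y.
      by rewrite -!fcell fx kp fy ecell; split.
    (* As [f] is both strictly increasing and constant, [o] is a single point, and it occurs in [h]
       at [x0]. *)
    have o1 (y z : 'I_(gsize o)) : y = z.
      by apply/val_inj; case: (ltngtP y z) => // /fmono; rewrite !fall ltnn.
    apply: (hO o Oo); exists (fun=> x0); split=> [y z|y z|y].
    + by rewrite (o1 y z) ltnn.
    + by rewrite (o1 y z) !ltnn.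
    + by rewrite -fcell fall kp.
  (* An occurrence missing [p] factors through [e], so [o] already occurs in [g]. *)
  have fe y : exists x, f y = e x.
    by case: (kcov (f y)) => // fy; exfalso; apply: nfp; exists y.
  have [f' f'E] := choice fe.
  apply: (gO o Oo); exists f'; split=> [y z yz|y z|y].
  + by rewrite -emono -!f'E; apply: fmono.
  + by rewrite -eperm -!f'E; apply: fperm.
  + by rewrite -ecell -f'E.
- move=> L /gR[l Ll gl]; exists l => //; exact: gcontains_trans _ _ _ kg gl.
Qed.

Theorem theorem6p15 (T : tiling) (m : nat) (P : 'I_m -> set cell)
    (m_neq1 : m <> 1)
    (P_partition : classical_sets.partition [set: 'I_m] P (nonempty_cells T))
    (P_non_interacting : non_interacting T P)
    (children_nontrivial :
       forall i : 'I_m, exists g : gperm, child T (P i) g /\ 1 <= gsize g) :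
  productive (Grid T) (fun i : 'I_m => child T (P i))
    (factor_reliance (fun i : 'I_m => child T (P i))).
Proof.
split=> [i n|i /factor_reliance_geP niS].
  rewrite /factor_reliance; case: asboolP => _ //.
  by rewrite Num.Theory.gerBl.
have sub := child_sub_Grid T m P i P_partition P_non_interacting niS.
split=> [n|]; first exact: (leq_gcount _ _ _ _ _ sub (@Grid_gridded T)).
(* Were [i] the only index, ['I_m] would have exactly one element, against [m_neq1]. *)
have [j ji] : exists j : 'I_m, j != i.
  apply: contrapT => nj; apply: m_neq1; rewrite -[LHS]card_ord.
  apply/eqP/fintype1P; exists i => j.
  by apply/eqP; apply: contrapT => /negP ji; apply: nj; exists j.
have [g [gi _]] := children_nontrivial i.
have [h [hj h1]] := children_nontrivial j.
have [k kG nk] := Grid_minus_child T m P i j g h P_partition P_non_interacting ji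
  (sub g gi) gi hj h1.
by exists (gsize k); apply: (ltn_gcount _ _ _ _ _ sub (@Grid_gridded T)).
Qed.
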